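(* Let $W$ be the Weyl group of classical finite type ($A_n$, $B_n$, $C_n$ or $D_n$) with index set $I$, let $\mathbf{i}=i_1\cdots i_l$ be a reduced word of the longest element $w_0\in W$, and let $\mathbb{B}_{\mathbf{i}}=B_{i_1}\otimes\cdots\otimes B_{i_l}$ be the cellular crystal associated with $\mathbf{i}$. For $x\in\mathbb{B}_{\mathbf{i}}$, the following are equivalent. (1) $\mathrm{wt}(x)=0$ and $\varepsilon_i^*(x)=0$ for all $i\in I$. (2) $x=(0)_{i_1}\otimes\cdots\otimes(0)_{i_l}\in\mathbb{B}_{\mathbf{i}}$.
   Context: Let $A=(a_{ij})_{i,j\in I}$ be the Cartan matrix, $a_{ij}=\langle h_i,\alpha_j\rangle$, with simple roots $\alpha_i$ and simple coroots $h_i$, and let $W$ be generated by the simple reflections $s_i$. A word $i_1\cdots i_l$ is a reduced word of $w$ if $w=s_{i_1}\cdots s_{i_l}$ with $l$ minimal. For $i\in I$ set $B_i=\{(z)_i\mid z\in\mathbb{Z}\}$, with $\mathrm{wt}((z)_i)=z\alpha_i$. As a set, $\mathbb{B}_{\mathbf{i}}=B_{i_1}\otimes\cdots\otimes B_{i_l}$ is $\{(z_1)_{i_1}\otimes\cdots\otimes(z_l)_{i_l}\mid z_k\in\mathbb{Z}\}$, and $\mathrm{wt}((z_1)_{i_1}\otimes\cdots\otimes(z_l)_{i_l})=\sum_{k=1}^l z_k\alpha_{i_k}$. Braid-type isomorphisms (these are isomorphisms of crystals, in particular bijections): - If $a_{ij}a_{ji}=0$, $i\neq j$: $B_i\otimes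 B_j\to B_j\otimes B_i$, $(z_1)_i\otimes(z_2)_j\mapsto(z_2)_j\otimes(z_1)_i$. - If $a_{ij}a_{ji}=1$: $B_i\otimes B_j\otimes B_i\to B_j\otimes B_i\otimes B_j$, $(z_1)_i\otimes(z_2)_j\otimes(z_3)_i\mapsto(\max(z_3,z_2-z_1))_j\otimes(z_1+z_3)_i\otimes(-\max(-z_1,z_3-z_2))_j$. - If $a_{ij}=-1$, $a_{ji}=-2$: $B_i\otimes B_j\otimes B_i\otimes B_j\to B_j\otimes B_i\otimes B_j\otimes B_i$, $(z_1)_i\otimes(z_2)_j\otimes(z_3)_i\otimes(z_4)_j\mapsto(y_1)_j\otimes(y_2)_i\otimes(y_3)_j\otimes(y_4)_i$ with $y_1=\max(z_4,z_2-2z_1,2z_3-z_2)$, $y_2=\max(z_1+z_4,z_3,z_1-z_2+2z_3)$, $y_3=-\max(-z_2,-z_4-2z_1,-2z_2+2z_3-z_4)$, $y_4=-\max(-z_3+z_4,-z_1,z_3-z_2)$. - If $a_{ij}=-1$, $a_{ji}=-2$, the inverse of the previous map: $B_j\otimes B_i\otimes B_j\otimes B_i\to B_i\otimes B_j\otimes B_i\otimes B_j$, $(z_1)_j\otimes(z_2)_i\otimes(z_3)_j\otimes(z_4)_i\mapsto(y_1)_i\otimes(y_2)_j\otimes(y_3)_i\otimes(y_4)_j$ with $y_1=\max(z_3-z_2,z_2-z_1,z_4)$, $y_2=\max(z_1-2z_2+2z_3,z_3,z_1+2z_4)$, $y_3=-\max(-2z_2+z_3-z_4,-z_1-z_4,-z_2)$,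 $y_4=-\max(-2z_2+z_3,-z_1,2z_4-z_3)$. A braid move on a reduced word replaces a consecutive subword $ij$ by $ji$ (if $a_{ij}a_{ji}=0$), $iji$ by $jij$ (if $a_{ij}a_{ji}=1$), or $ijij$ by $jiji$ (if $a_{ij}a_{ji}=2$). It induces a bijection between the corresponding cellular crystals by applying the braid-type isomorphism to the corresponding consecutive tensor factors and the identity to the others. Definition of $\varepsilon_i^*$: since $\mathbf{i}$ is a reduced word of $w_0$, for every $i\in I$ some sequence of braid moves transforms $\mathbf{i}$ into a reduced word of $w_0$ of the form $\mathbf{i}'i$. Let $\phi:\mathbb{B}_{\mathbf{i}}\to\mathbb{B}_{\mathbf{i}'}\otimes B_i$ be the composition of the induced isomorphisms. If $\phi(x)=b'\otimes(a)_i$, set $\varepsilon_i^*(x)=-a$. It is known that this does not depend on the choice of braid moves or of $\mathbf{i}'$. *)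

(* Defs.v *)
From Stdlib Require Import ClassicalEpsilon.
From mathcomp Require Import all_boot all_order all_algebra.

Set Implicit Arguments.
Unset Strict Implicit.
Unset Printing Implicit Defensive.

Import Order.TTheory GRing.Theory Num.Theory.
Local Open Scope ring_scope.

Inductive classical_type := TypeA | TypeB | TypeC | TypeD.

Definition rank_ok (t : classical_type) (n : nat) : bool :=
  match t with
  | TypeA => (0 < n)%N
  | TypeB | TypeC => (1 < n)%N
  | TypeD => (3 < n)%N
  end.

(* Edge i -- j, for i < j, of the Dynkin diagram on the nodes 0, ..., n - 1.
   In type D the last node n - 1 is joined to n - 3 instead of n - 2. *)
Definition dynkin_edge (t : classical_type) (n i j : nat) : bool :=
  match t with
  | TypeD => if j == n.-1 then i.+2 == j else i.+1 == j
  | _ => i.+1 == j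
  end.

(* Bourbaki labelling shifted to start at 0, with a_ij = <h_i, alpha_j>: the
   last simple root is short in type B and long in type C. *)
Definition cartan (t : classical_type) (n : nat) : 'M[int]_n :=
  \matrix_(i, j)
    if i == j then 2 else
    if dynkin_edge t n i j || dynkin_edge t n j i then
      match t with
      | TypeB => if val i == n.-1 then -2 else -1
      | TypeC => if val j == n.-1 then -2 else -1
      | _ => -1
      end
    else 0.

Section WeylGroup.

Variables (n : nat) (A : 'M[int]_n).

(* The root lattice is 'cV[int]_n. *)
Definition simple_root (i : 'I_n) : 'cV[int]_n := delta_mx i 0.

(* s_i (alpha_j) = alpha_j - a_ij alpha_i; W is realized by its action on the
   root lattice, which is faithful in finite type. *)
Definition simple_refl (i : 'I_n) : 'M[int]_n :=
  \matrix_(k, j) ((k == j)%:R - (k == i)%:R * A i j).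

Definition word_elt (s : seq 'I_n) : 'M[int]_n :=
  \big[mulmx/1%:M]_(i <- s) simple_refl i.

Definition reduced_word (w : 'M[int]_n) (s : seq 'I_n) : Prop :=
  word_elt s = w /\ forall t, word_elt t = w -> (size s <= size t)%N.

Definition has_length (w : 'M[int]_n) (l : nat) : Prop :=
  exists2 s, reduced_word w s & size s = l.

Definition longest_element (w0 : 'M[int]_n) : Prop :=
  exists2 l0, has_length w0 l0 &
    forall w l, has_length w l -> (l <= l0)%N.

End WeylGroup.

Section CellularCrystal.

Variable n : nat.

(* The pair (i, z) stands for (z)_i in B_i, and the sequence
   [:: (i_1, z_1); ...; (i_l, z_l)] for (z_1)_{i_1} (x) ... (x) (z_l)_{i_l}. *)
Definition tensor := seq ('I_n * int).

Definition cellular (s : seq 'I_n) : pred tensor := fun x => unzip1 x == s.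

Definition cellular_zero (s : seq 'I_n) : tensor := [seq (i, 0) | i <- s].

Definition wt (x : tensor) : 'cV[int]_n :=
  \sum_(b <- x) b.2 *: simple_root b.1.

Variable A : 'M[int]_n.

Local Notation max := Num.max.

(* The braid-type isomorphisms; None when the letters of x are not the source
   of a braid move. *)
Definition braid_iso (x : tensor) : option tensor :=
  match x with
  | [:: (i, z1); (j, z2)] =>
      if (i != j) && (A i j * A j i == 0)
      then Some [:: (j, z2); (i, z1)] else None
  | [:: (i, z1); (j, z2); (i', z3)] =>
      if (i' == i) && (A i j * A j i == 1)
      then Some [:: (j, max z3 (z2 - z1)); (i, z1 + z3);
                    (j, - max (- z1) (z3 - z2))]
      else None
  | [:: (i, z1); (j, z2); (i', z3); (j', z4)] =>
      if (i' == i) && (j' == j) then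
        if (A i j == -1) && (A j i == -2) then
          Some [:: (j, max z4 (max (z2 - 2 * z1) (2 * z3 - z2)));
                   (i, max (z1 + z4) (max z3 (z1 - z2 + 2 * z3)));
                   (j, - max (- z2) (max (- z4 - 2 * z1)
                                         (- (2 * z2) + 2 * z3 - z4)));
                   (i, - max (- z3 + z4) (max (- z1) (z3 - z2)))]
        else if (A i j == -2) && (A j i == -1) then
          Some [:: (j, max (z3 - z2) (max (z2 - z1) z4));
                   (i, max (z1 - 2 * z2 + 2 * z3) (max z3 (z1 + 2 * z4)));
                   (j, - max (- (2 * z2) + z3 - z4)
                             (max (- z1 - z4) (- z2)));
                   (i, - max (- (2 * z2) + z3) (max (- z1) (2 * z4 - z3)))]
        else None
      else None
  | _ => None
  end.

(* A braid move km = (k, m) acts on the m consecutive factors of x that follow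
   the first k. *)
Definition braid_move (km : nat * nat) (x : tensor) : option tensor :=
  let: (k, m) := km in
  omap (fun y => take k x ++ y ++ drop (k + m) x)
       (braid_iso (take m (drop k x))).

Fixpoint braid_moves (p : seq (nat * nat)) (x : tensor) : option tensor :=
  if p is km :: p' then obind (braid_moves p') (braid_move km x) else Some x.

(* The moves p transform the word s into a word of the form s' i. Braid moves
   preserve the length and the element of the Weyl group, hence reducedness. *)
Definition star_moves (i : 'I_n) (s : seq 'I_n) (p : seq (nat * nat)) : Prop :=
  exists s', forall x, cellular s x ->
    exists b a, cellular s' b /\ braid_moves p x = Some (rcons b (i, a)).

(* When s is a reduced word of the longest element, star_moves i s is inhabited
   and the result does not depend on the chosen p. The default values are
   irrelevant in that case. *)
Definition eps_star (i : 'I_n) (x : tensor) : int :=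
  let p := epsilon (inhabits [::]) (star_moves i (unzip1 x)) in
  if braid_moves p x is Some y then - (last (i, 0) y).2 else 0.

End CellularCrystal.

(* Main.v *)
Require Import Defs.
From Stdlib Require Import Classical ClassicalEpsilon.
From mathcomp Require Import all_boot all_order all_algebra.
From mathcomp Require Import zify ring.

Set Implicit Arguments.
Unset Strict Implicit.
Unset Printing Implicit Defensive.

Import Order.TTheory GRing.Theory Num.Theory.
Local Open Scope ring_scope.

(** Braid-type isomorphisms send zero coordinates to zero coordinates, so the
zero tensor has weight 0 and all its eps_star vanish. The converse rests on two
facts about a reduced word s of the longest element w0.

Positivity (coords_nonneg): if all the tensors reached from x by braid moves
have a nonnegative last coordinate, then all coordinates of x are nonnegative.
Indeed let s = u j i v and let z be the coordinate of x at this letter j. Braid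
moves inside u, and inside i v, bring the longest word of the subgroup generated
by s_i and s_j around the letter j without changing z: there is enough room on
the right because every reduced word extends to a reduced word of w0. What
follows this block is shorter than i v, so by induction the last coordinate of
the block is nonnegative, and so is the last coordinate of its image under the
braid-type isomorphism. In rank two these two inequalities force all the
coordinates of the block to be nonnegative (braid_rule_nonneg). The argument
uses finitely many sequences of moves, which depend on s but not on x.

Independence (paths_agree): two sequences of moves from s to the same word have
the same effect. The braid-type isomorphisms commute with the Kashiwara
operators e_j and f_j (relation raises). Suppose that the finitely many last
coordinates of the positivity argument are nonnegative on x. Then x is
nonnegative, and if x <> 0 its last nonzero coordinate shows that
phi_j(x) > 0 for some j; f_j then changes none of those last coordinates to a
negative number, because a last coordinate on which f_j acts equals phi_j(x). By
induction on the sum of the coordinates, x is obtained from 0 by operators e_j;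
the two sequences agree on 0, hence on x. An arbitrary x is brought to this case
by translation: an integral weight la gives a vector of coordinates (shift la),
and translation by it commutes with braid moves and adds <h_i, la> to a last
coordinate at a letter i, so a large multiple of rho suffices.

By Matsumoto's theorem and independence, eps_star i x is minus the last
coordinate of any tensor reached from x whose last letter is i. If all eps_star
vanish, positivity gives nonnegative coordinates, and their sum is the sum of
the coordinates of wt x = 0. *)

(** * Cartan matrices and simple reflections *)

(** All that is used of the classical types: every rank two submatrix has
type A1 x A1, A2, B2 or C2, the types for which a braid-type isomorphism is
given. *)
Definition cartan_like (n : nat) (A : 'M[int]_n) : Prop :=
  (forall i, A i i = 2) /\
  (forall i j, i != j ->
    [\/ A i j = 0 /\ A j i = 0, A i j = -1 /\ A j i = -1,
        A i j = -1 /\ A j i = -2 | A i j = -2 /\ A j i = -1]).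

Lemma cartan_cartan_like (t : classical_type) (n : nat) : cartan_like (cartan t n).
Proof.
split=> [i|i j ij]; first by rewrite mxE eqxx.
have ji : j != i by rewrite eq_sym.
rewrite !mxE (negbTE ij) (negbTE ji) orbC.
case: ifP => [|_]; last by constructor 1.
have ij' : val i != val j by apply: contra ij => /eqP/val_inj/eqP.
have [ltin ltjn] := (ltn_ord i, ltn_ord j).
move: ltin ltjn ij'; case: t => /=; do ?[case: eqP]; do ?[case: eqP];
  move=> *; solve [by constructor 2|by constructor 3|by constructor 4|lia].
Qed.

Section RootLattice.

Variables (n : nat) (A : 'M[int]_n).

Local Notation word := (seq 'I_n).
Local Notation W := (word_elt A).
Local Notation s_ := (simple_refl A).
Local Notation alpha := (@simple_root n).

Definition nonneg (v : 'cV[int]_n) : Prop := forall k, 0 <= v k 0.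

Lemma eq_on_roots (M N : 'M[int]_n) : (forall k, M *m alpha k = N *m alpha k) -> M = N.
Proof.
by move=> MN; apply/matrixP => i k; move/colP/(_ i): (MN k); rewrite -!colE !mxE.
Qed.

Lemma word_elt_nil : W [::] = 1%:M.
Proof. by rewrite /word_elt big_nil. Qed.

Lemma word_elt_cons i s : W (i :: s) = s_ i *m W s.
Proof. by rewrite /word_elt big_cons. Qed.

Lemma word_elt_cat s t : W (s ++ t) = W s *m W t.
Proof.
by elim: s => [|i s IH]; rewrite ?word_elt_nil ?mul1mx //= !word_elt_cons IH mulmxA.
Qed.

Lemma word_elt1 i : W [:: i] = s_ i.
Proof. by rewrite word_elt_cons word_elt_nil mulmx1. Qed.

Lemma word_elt_rcons s i : W (rcons s i) = W s *m s_ i.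
Proof. by rewrite -cats1 word_elt_cat word_elt1. Qed.

Definition pairing (i : 'I_n) (v : 'cV[int]_n) : int := (A *m v) i 0.

Lemma pairingB i u v : pairing i (u - v) = pairing i u - pairing i v.
Proof. by rewrite /pairing mulmxBr !mxE. Qed.

Lemma pairingZ i c v : pairing i (c *: v) = c * pairing i v.
Proof. by rewrite /pairing -scalemxAr mxE. Qed.

Lemma pairing_root i j : pairing i (alpha j) = A i j.
Proof. by rewrite /pairing /simple_root -colE mxE. Qed.

Lemma simple_reflE i v : s_ i *m v = v - pairing i v *: alpha i.
Proof.
apply/colP => k; rewrite /pairing !mxE.
under eq_bigr => j _ do rewrite !mxE mulrBl -mulrA.
rewrite sumrB -mulr_sumr; congr (_ - _).
  rewrite (bigD1 k) //= eqxx mul1r big1 ?addr0 // => j jk.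
  by rewrite eq_sym (negbTE jk) mul0r.
by rewrite andbT mulrC.
Qed.

Lemma simple_refl_root i j : s_ i *m alpha j = alpha j - A i j *: alpha i.
Proof. by rewrite simple_reflE pairing_root. Qed.

Hypothesis HA : cartan_like A.

Let Aii i : A i i = 2. Proof. by case: HA. Qed.

Lemma simple_reflN i : s_ i *m alpha i = - alpha i.
Proof. by rewrite simple_refl_root Aii scaler_nat mulr2n opprD addNKr. Qed.

Lemma simple_reflK i : s_ i *m s_ i = 1%:M.
Proof.
apply: eq_on_roots => k; rewrite -mulmxA mul1mx !(simple_reflE, pairingB, pairingZ).
by rewrite !pairing_root Aii; apply/colP => l; rewrite !mxE; ring.
Qed.

Lemma word_elt_revK s : W s *m W (rev s) = 1%:M.
Proof.
elim: s => [|i s IH]; first by rewrite /rev /= word_elt_nil mulmx1.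
rewrite rev_cons word_elt_cons word_elt_rcons mulmxA -(mulmxA _ (W s)) IH mulmx1.
exact: simple_reflK.
Qed.

Lemma word_elt_revVK s : W (rev s) *m W s = 1%:M.
Proof. by rewrite -{2}(revK s) word_elt_revK. Qed.

Lemma word_elt_inj s (u v : 'cV_n) : W s *m u = W s *m v -> u = v.
Proof.
by move/(congr1 (mulmx (W (rev s)))); rewrite !mulmxA word_elt_revVK !mul1mx.
Qed.

Lemma eq_word_elt_rev s t : W s = W t -> W (rev s) = W (rev t).
Proof.
move=> st; rewrite -[LHS]mulmx1 -(word_elt_revK t) mulmxA -st.
by rewrite word_elt_revVK mul1mx.
Qed.

(** The alternating words of the dihedral subgroup of s_i and s_j, indexed by
their last letter j because descents are read at the end of a word. *)
Fixpoint alt (k : nat) (i j : 'I_n) : word :=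
  if k is k'.+1 then rcons (alt k' j i) j else [::].

Lemma alt_cons k i j : alt k.+1 i j = (if odd k then i else j) :: alt k i j.
Proof.
elim: k i j => // k IH i j.
by rewrite -[LHS]/(rcons (alt k.+1 j i) j) IH rcons_cons /= if_neg.
Qed.

Lemma size_alt k i j : size (alt k i j) = k.
Proof. by elim: k i j => //= k IH i j; rewrite size_rcons IH. Qed.

Lemma alt_suffix k m i j : (m <= k)%N -> exists u, alt k i j = u ++ alt m i j.
Proof.
elim: k => [|k IH]; first by case: m => // _; exists [::].
rewrite leq_eqVlt => /predU1P[->|/IH[u Eu]]; first by exists [::].
by rewrite alt_cons Eu; eexists (_ :: u).
Qed.

(** The order of s_i s_j, that is the length of a braid relation. *)
Definition bond (i j : 'I_n) : nat :=
  if A i j * A j i == 0 then 2 else if A i j * A j i == 1 then 3 else 4.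

Lemma bondC i j : bond i j = bond j i.
Proof. by rewrite /bond mulrC. Qed.

Lemma bond_gt1 i j : (1 < bond i j)%N.
Proof. by rewrite /bond; do 2?case: ifP. Qed.

Ltac refl_expand :=
  rewrite ?(word_elt_cons, word_elt_nil, mulmx1) -?mulmxA;
  repeat rewrite !(simple_reflE, pairingB, pairingZ, pairing_root) ?Aii.

Lemma alt_braid i j : i != j -> W (alt (bond i j) i j) = W (alt (bond i j) j i).
Proof.
move=> ij; apply: eq_on_roots => k.
by rewrite /bond; case: HA => _ /(_ i j ij)[] [Eij Eji]; rewrite Eij Eji /=;
  refl_expand; rewrite ?Eij ?Eji; apply/colP => l; rewrite !mxE; ring.
Qed.

(** An alternating word that ends with j and is shorter than the longest one has
no descent at i: it sends alpha_i to a positive root of the rank two system. *)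
Lemma alt_root k i j : i != j -> (k < bond i j)%N ->
  exists c d : int, [/\ 0 <= c, 0 <= d &
    W (alt k i j) *m alpha i = c *: alpha i + d *: alpha j].
Proof.
move=> ij; rewrite /bond; case: HA => _ /(_ i j ij)[] [Eij Eji]; rewrite Eij Eji /=;
  case: k => [|[|[|[|//]]]] //= _; refl_expand; rewrite ?mul1mx ?Eij ?Eji.
- by exists 1, 0; split=> //; apply/colP => l; rewrite !mxE; ring.
- by exists 1, 0; split=> //; apply/colP => l; rewrite !mxE; ring.
- by exists 1, 0; split=> //; apply/colP => l; rewrite !mxE; ring.
- by exists 1, 1; split=> //; apply/colP => l; rewrite !mxE; ring.
- by exists 0, 1; split=> //; apply/colP => l; rewrite !mxE; ring.
- by exists 1, 0; split=> //; apply/colP => l; rewrite !mxE; ring.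
- by exists 1, 2; split=> //; apply/colP => l; rewrite !mxE; ring.
- by exists 1, 2; split=> //; apply/colP => l; rewrite !mxE; ring.
- by exists 1, 0; split=> //; apply/colP => l; rewrite !mxE; ring.
- by exists 1, 0; split=> //; apply/colP => l; rewrite !mxE; ring.
- by exists 1, 1; split=> //; apply/colP => l; rewrite !mxE; ring.
- by exists 1, 1; split=> //; apply/colP => l; rewrite !mxE; ring.
- by exists 1, 0; split=> //; apply/colP => l; rewrite !mxE; ring.
Qed.
End RootLattice.

(** * Reduced words *)

Section ReducedWords.

Variables (n : nat) (A : 'M[int]_n).

Local Notation word := (seq 'I_n).
Local Notation W := (word_elt A).
Local Notation alpha := (@simple_root n).
Hypothesis HA : cartan_like A.

Definition reduced (s : word) : Prop :=
  forall t, W t = W s -> (size s <= size t)%N.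

(** For reduced s this says that some reduced word of the same element ends
with i. Asking for a shorter word only would require a parity argument
afterwards. *)
Definition descent (s : word) (i : 'I_n) : Prop :=
  exists u, W (rcons u i) = W s /\ (size u).+1 = size s.

Lemma exists_reduced s : exists t, reduced t /\ W t = W s.
Proof.
elim: {s}_.+1 {-2}s (ltnSn (size s)) => // m IH s sm.
have [|nred] := classic (reduced s); first by exists s.
have [t nt] := not_all_ex_not _ _ nred.
have [Ets /negP] := imply_to_and _ _ nt; rewrite -ltnNge => lts.
have [r [rr Er]] := IH t (leq_trans lts sm).
by exists r; rewrite Er.
Qed.

Lemma reduced_eq s t : reduced s -> W t = W s -> size t = size s -> reduced t.
Proof. by move=> rs Ets st r Er; rewrite st; apply: rs; rewrite Er. Qed.

Lemma reduced_catl s t : reduced (s ++ t) -> reduced s.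
Proof.
move=> r u Eu; have := r (u ++ t); rewrite !word_elt_cat Eu !size_cat leq_add2r.
exact.
Qed.

Lemma reduced_catr s t : reduced (s ++ t) -> reduced t.
Proof.
move=> r u Eu; have := r (s ++ u); rewrite !word_elt_cat Eu !size_cat leq_add2l.
exact.
Qed.

Lemma reduced_rev s : reduced s -> reduced (rev s).
Proof.
move=> rs t Et; rewrite size_rev -(size_rev t); apply: rs.
by rewrite (eq_word_elt_rev HA Et) revK.
Qed.

Lemma word_elt_rcons2 s i : W (rcons (rcons s i) i) = W s.
Proof. by rewrite !word_elt_rcons -mulmxA simple_reflK // mulmx1. Qed.

Lemma word_elt_cat_inj u s t : W (u ++ s) = W (u ++ t) -> W s = W t.
Proof.
rewrite !word_elt_cat => /(congr1 (mulmx (W (rev u)))).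
by rewrite !mulmxA word_elt_revVK // !mul1mx.
Qed.

Lemma word_elt_rcons_inj s t i : W (rcons s i) = W (rcons t i) -> W s = W t.
Proof.
by rewrite !word_elt_rcons => /(congr1 (mulmxr (simple_refl A i))) /=;
  rewrite -!mulmxA simple_reflK // !mulmx1.
Qed.

Lemma reduced_rcons_descent s i : reduced (rcons s i) -> ~ descent s i.
Proof.
move=> r [u [Eu su]]; have := r u.
by rewrite size_rcons word_elt_rcons -Eu -word_elt_rcons word_elt_rcons2 -su ltnNge leqnSn /=;
  move/(_ erefl).
Qed.

Lemma descent_rcons s i : descent (rcons s i) i.
Proof. by exists s; rewrite size_rcons. Qed.

(** Factorization through the minimal representative v of the coset of the
dihedral subgroup: letters i and j are moved from the prefix to the alternating
word as long as the prefix has a descent i or j. A descent at the letter that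
begins the alternating word is impossible, as that letter would cancel. *)
Lemma dihedral_factor u k i j : reduced (u ++ alt k.+1 i j) ->
  exists v m, [/\ (k < m)%N, W (v ++ alt m i j) = W (u ++ alt k.+1 i j),
    (size v + m)%N = (size u + k.+1)%N, ~ descent v i & ~ descent v j].
Proof.
elim: {u}_.+1 {-2}u k (ltnSn (size u)) => // N IH u k uN r.
set x := if odd k then i else j; set y := if odd k then j else i.
have ndx : ~ descent u x.
  apply: reduced_rcons_descent; rewrite -cats1.
  by move: r; rewrite alt_cons -cat1s catA => /reduced_catl.
have [[v [Ev sv]]|ndy] := classic (descent u y); last first.
  by exists u, k.+1; split=> //; rewrite /x /y in ndx ndy; case: odd ndx ndy.
have E : W (v ++ alt k.+2 i j) = W (u ++ alt k.+1 i j).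
  by rewrite alt_cons /= if_neg -/y -cat_rcons !(word_elt_cat _ (rcons _ _)) !word_elt_cat Ev.
have S : size (v ++ alt k.+2 i j) = size (u ++ alt k.+1 i j).
  by rewrite !size_cat !size_alt -sv addSnnS.
have [||w [m [km Ew Sw ? ?]]] := IH v k.+1.
- by rewrite -sv in uN.
- exact: reduced_eq E S.
exists w, m; split=> //; [exact: ltnW|by rewrite Ew|].
by rewrite Sw -sv addSnnS.
Qed.

Lemma nonneg_comb u c d i j : 0 <= c -> 0 <= d ->
  nonneg (W u *m alpha i) -> nonneg (W u *m alpha j) ->
  nonneg (W u *m (c *: alpha i + d *: alpha j)).
Proof.
move=> c0 d0 Hi Hj k; rewrite mulmxDr -!scalemxAr mxE [X in X + _]mxE [X in _ + X]mxE.
by rewrite addr_ge0 // mulr_ge0.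
Qed.

Lemma alt_descent u k i j : i != j -> (bond A i j <= k)%N -> descent (u ++ alt k i j) i.
Proof.
move=> ij bk; have [v ->] := alt_suffix i j bk.
have := alt_braid HA ij; case: (bond _ _ _) (bond_gt1 A i j) => // m _ Em.
exists (u ++ v ++ alt m i j); rewrite !rcons_cat -[rcons _ _]/(alt m.+1 j i).
by rewrite !(word_elt_cat _ u) !(word_elt_cat _ v) Em !size_cat !size_alt !addnS.
Qed.

Lemma descent_eq s t i : W s = W t -> size s = size t -> descent s i -> descent t i.
Proof. by move=> E S [u [Eu su]]; exists u; rewrite Eu su. Qed.

(** The link between lengths and signs of roots. Write s = v d with d
alternating and v minimal in its coset: by induction v sends alpha_i and alpha_j
to positive roots, and d sends alpha_i to a nonnegative combination of them,
unless d is so long that a braid relation produces a descent at i. *)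
Lemma nonneg_root s i : reduced s -> ~ descent s i -> nonneg (W s *m alpha i).
Proof.
elim: {s}_.+1 {-2}s i (ltnSn (size s)) => // N IH s i; case/lastP: s => [|s j] sN rs nd.
  by move=> k; rewrite word_elt_nil mul1mx !mxE; case: andb.
have ij : i != j by apply/eqP => ij; apply: nd; rewrite ij; exact: descent_rcons.
have rs' := rs; rewrite -cats1 -[[:: j]]/(alt 1 i j) in rs'.
have [v [m [m0 Ev Sv ndi ndj]]] := dihedral_factor rs'.
have Sv' : size (v ++ alt m i j) = size (rcons s j).
  by rewrite size_cat size_alt Sv size_rcons addn1.
have rv : reduced v.
  by apply: (@reduced_catl _ (alt m i j)); apply: (reduced_eq rs'); rewrite // cats1.
have vN : (size v < N)%N by move: sN; rewrite -Sv' size_cat size_alt; lia.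
have mb : (m < bond A i j)%N.
  rewrite ltnNge; apply/negP => bm; apply: nd.
  by apply: descent_eq Sv' (alt_descent v ij bm); rewrite Ev cats1.
have [c [d [c0 d0 E]]] := alt_root HA ij mb.
rewrite -cats1 -[[:: j]]/(alt 1 i j) -Ev word_elt_cat -mulmxA E.
by apply: nonneg_comb => //; apply: IH.
Qed.

Lemma root_neq0 s i : W s *m alpha i <> 0.
Proof.
rewrite -(mulmx0 _ (W s)) => /(word_elt_inj HA)/colP/(_ i).
by rewrite !mxE !eqxx.
Qed.

Lemma nonneg_oppF s i : nonneg (W s *m alpha i) -> nonneg (- (W s *m alpha i)) -> False.
Proof.
move=> p m; apply: (@root_neq0 s i); apply/colP => k; apply/eqP.
by have := p k; have := m k; rewrite !mxE oppr_ge0 => p' m'; rewrite eq_le p' m'.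
Qed.

Lemma word_elt_reflN s i : W (rcons s i) *m alpha i = - (W s *m alpha i).
Proof. by rewrite word_elt_rcons -mulmxA simple_reflN // mulmxN. Qed.

Lemma descent_nonpos s i : reduced s -> descent s i -> nonneg (- (W s *m alpha i)).
Proof.
move=> rs [u [Eu su]]; rewrite -Eu word_elt_reflN opprK.
have r : reduced (rcons u i) by apply: (reduced_eq rs); rewrite ?size_rcons.
apply: nonneg_root (reduced_rcons_descent r).
by move: r; rewrite -cats1 => /reduced_catl.
Qed.

Lemma nonpos_descent s i : reduced s -> nonneg (- (W s *m alpha i)) -> descent s i.
Proof. by move=> rs m; apply: NNPP => nd; exact: nonneg_oppF (nonneg_root rs nd) m. Qed.

Lemma nonneg_reduced_rcons s i : reduced s -> nonneg (W s *m alpha i) ->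
  reduced (rcons s i).
Proof.
move=> rs p t Et; have [r [rr Er]] := exists_reduced (rcons s i).
have [|u [Eu su]] := @nonpos_descent r i rr.
  by rewrite Er word_elt_reflN opprK.
suff: (size (rcons s i) <= size r)%N.
  by move/leq_trans; apply; apply: rr; rewrite Et Er.
rewrite size_rcons -su ltnS; apply: rs; apply: (@word_elt_rcons_inj _ _ i).
by rewrite Eu.
Qed.

Inductive braid_eqv : word -> word -> Prop :=
| Braid_refl s : braid_eqv s s
| Braid_step a b i j s : i != j ->
    braid_eqv (a ++ alt (bond A i j) j i ++ b) s ->
    braid_eqv (a ++ alt (bond A i j) i j ++ b) s.

Lemma braid_eqv_trans s t u : braid_eqv s t -> braid_eqv t u -> braid_eqv s u.
Proof. by elim=> // a b i j s' ij _ IH /IH; apply: Braid_step. Qed.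

Lemma braid_eqv_cat a b s t : braid_eqv s t -> braid_eqv (a ++ s ++ b) (a ++ t ++ b).
Proof.
elim=> [u|a' b' i j u ij _ IH]; first by left.
by move: IH; rewrite -!catA !(catA a); apply: Braid_step.
Qed.

Lemma braid_eqv_rcons s t i : braid_eqv s t -> braid_eqv (rcons s i) (rcons t i).
Proof. by move/(braid_eqv_cat [::] [:: i]); rewrite /= !cats1. Qed.

(** With two descents i and j the dihedral part must be the longest word:
otherwise nonneg_root for v would make s.alpha_i positive. *)
Lemma two_descents s i j : reduced s -> i != j -> descent s i -> descent s j ->
  exists u, W (u ++ alt (bond A i j) i j) = W s /\ (size u + bond A i j)%N = size s.
Proof.
move=> rs ij di [s' [Es' Ss']].
have rs' : reduced (s' ++ alt 1 i j).
  by rewrite cats1; apply: (reduced_eq rs); rewrite ?size_rcons.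
have [v [m [m0 Ev Sv ndi ndj]]] := dihedral_factor rs'.
rewrite cats1 Es' addn1 Ss' in Ev Sv.
case: (leqP (bond A i j) m) => [bm|mb].
  have [w Ew] := alt_suffix i j bm; exists (v ++ w); rewrite -catA -Ew; split=> //.
  by rewrite -Sv -(size_alt m i j) Ew !size_cat size_alt addnA.
have [c [d [c0 d0 E]]] := alt_root HA ij mb.
have rv : reduced v.
  by apply: (@reduced_catl _ (alt m i j)); apply: (reduced_eq rs); rewrite // size_cat size_alt.
case: (@nonneg_oppF s i); last exact: descent_nonpos.
rewrite -Ev word_elt_cat -mulmxA E.
by apply: nonneg_comb => //; apply: nonneg_root.
Qed.

(** Matsumoto's theorem. Two words with the same last letter are handled by
induction on their prefixes; for distinct last letters i and j, two_descents
provides an intermediate pair of words that end with the two longest words of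
the dihedral subgroup and differ by one braid move. *)
Theorem matsumoto s t : reduced s -> W s = W t -> size s = size t -> braid_eqv s t.
Proof.
elim: {s}_.+1 {-2}s t (ltnSn (size s)) => // N IH s t; case/lastP: s => [|s i] sN rs Est.
  by case: t Est => // _ _; left.
case/lastP: t Est => [|t j]; first by rewrite size_rcons.
rewrite !size_rcons => Est [Sst].
have rt : reduced (rcons t j) by apply: (reduced_eq rs); rewrite ?size_rcons ?Sst.
have cut p q k : reduced (rcons p k) -> W (rcons p k) = W (rcons q k) ->
    size p = size q -> (size p < N)%N -> braid_eqv (rcons p k) (rcons q k).
  move=> rp Epq Spq pN; apply/braid_eqv_rcons/IH => //.
    by move: rp; rewrite -cats1 => /reduced_catl.
  exact: word_elt_rcons_inj Epq.
rewrite size_rcons ltnS in sN.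
have [ij|ij] := eqVneq i j; first by subst j; apply: cut.
have [||u [Eu Su]] := @two_descents (rcons s i) i j rs ij; first exact: descent_rcons.
  by rewrite /descent Est size_rcons Sst -(size_rcons t j); exact: descent_rcons.
have step : braid_eqv (u ++ alt (bond A i j) j i) (u ++ alt (bond A i j) i j).
  rewrite -[alt _ j i]cats0 -[alt _ i j]cats0 bondC.
  by apply: Braid_step; [rewrite eq_sym | left].
have := alt_braid HA ij; move: step.
case: (bond A i j) (bond_gt1 A i j) Eu Su => // m _ Eu.
rewrite size_rcons addnS => -[Su] step E.
have E' : W (u ++ alt m.+1 j i) = W (rcons s i) by rewrite word_elt_cat -E -word_elt_cat.
move: Eu E' step => /=; rewrite -!rcons_cat => Eu E' step.
have S1 : size (u ++ alt m i j) = size s by rewrite size_cat size_alt.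
have S2 : size (u ++ alt m j i) = size s by rewrite size_cat size_alt.
have c1 : braid_eqv (rcons s i) (rcons (u ++ alt m i j) i) by apply: cut.
apply: braid_eqv_trans c1 (braid_eqv_trans step _).
apply: (cut _ _ j); rewrite ?Eu ?S2 //.
by apply: (reduced_eq rs); rewrite // !size_rcons S2.
Qed.

Definition longest (s : word) : Prop :=
  reduced s /\ forall t, reduced t -> (size t <= size s)%N.

Lemma longest_eq s t : longest s -> W t = W s -> size t = size s -> longest t.
Proof.
move=> [rs ls] E S; split; first exact: reduced_eq E S.
by move=> r rr; rewrite S; apply: ls.
Qed.

Lemma longest_rev s : longest s -> longest (rev s).
Proof.
move=> [rs ls]; split; first exact: reduced_rev.
by move=> t rt; rewrite size_rev; apply: ls.
Qed.

Lemma longest_nonpos s i : longest s -> nonneg (- (W s *m alpha i)).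
Proof.
move=> [rs ls]; apply: descent_nonpos => //; apply: NNPP => nd.
have := ls _ (nonneg_reduced_rcons rs (nonneg_root rs nd)).
by rewrite size_rcons ltnn.
Qed.

Lemma nonpos_sum s (v : 'cV[int]_n) : longest s -> nonneg v -> nonneg (- (W s *m v)).
Proof.
move=> ls v0 k.
have -> : v = \sum_i v i 0 *: alpha i.
  apply/colP => l; rewrite summxE (bigD1 l) //= !mxE !eqxx mulr1 big1 ?addr0 // => i il.
  by rewrite !mxE eq_sym (negbTE il) mulr0.
rewrite mulmx_sumr -sumrN summxE; apply: sumr_ge0 => i _.
by rewrite -scalemxAr -scalerN mxE mulr_ge0 // longest_nonpos.
Qed.

(** The prefix is shortened as t grows to i :: t: a prefix u with u t = w0
sends alpha_i to w0 (t^-1 alpha_i), where t^-1 alpha_i is positive since i :: t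
is reduced, and w0 makes every positive root negative; hence i is a descent
of u. *)
Lemma longest_extl s t : longest s -> reduced t ->
  exists u, W (u ++ t) = W s /\ (size u + size t)%N = size s.
Proof.
move=> ls; elim: t => [|i t IH] rt; first by exists s; rewrite cats0 addn0.
have rt' : reduced t by apply: (@reduced_catr [:: i]).
have [u [Eu Su]] := IH rt'.
have ru : reduced u.
  apply: (@reduced_catl _ t); apply: (reduced_eq ls.1); rewrite // size_cat //.
have rti : reduced (rcons (rev t) i) by rewrite -rev_cons; exact: reduced_rev.
have [|v [Ev Sv]] := @nonpos_descent u i ru.
  have -> : W u *m alpha i = W s *m (W (rev t) *m alpha i).
    by rewrite -Eu mulmxA word_elt_cat -(mulmxA (W u)) word_elt_revK // mulmx1.
  apply: nonpos_sum => //; apply: nonneg_root; last exact: reduced_rcons_descent.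
  exact: reduced_rev.
exists v; rewrite -cat_rcons word_elt_cat Ev -word_elt_cat; split=> //=.
by rewrite -Su -Sv addSnnS.
Qed.

Lemma longest_extr s t : longest s -> reduced t ->
  exists u, W (t ++ u) = W s /\ (size t + size u)%N = size s.
Proof.
move=> /longest_rev ls /reduced_rev rt; have [u [Eu Su]] := longest_extl ls rt.
exists (rev u); rewrite -{1}(revK t) -rev_cat -(revK s) (eq_word_elt_rev HA Eu) revK.
by rewrite !size_rev in Su *; rewrite addnC.
Qed.

Lemma reduced_word_longest w0 s : longest_element A w0 -> reduced_word A w0 s -> longest s.
Proof.
move=> [l0 [s0 [Es0 rs0] <-] max] [Es rs]; rewrite -Es in rs rs0 Es0.
split=> // t rt; apply: leq_trans (max (W t) _ _) (rs0 _ erefl).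
by exists t.
Qed.
End ReducedWords.

(** * Braid-type isomorphisms and Kashiwara operators in rank two *)

Section RankTwo.

Variables (n : nat) (A : 'M[int]_n).
Hypothesis HA : cartan_like A.

Local Notation word := (seq 'I_n).
Local Notation tensor := (tensor n).
Local Notation max := Num.max.

Let Aii i : A i i = 2. Proof. by case: HA. Qed.

(** The graph of braid_iso, as an inductive relation that records the entries
of the Cartan matrix. *)
Inductive braid_rule : tensor -> tensor -> Prop :=
| Rule2 i j z1 z2 : i != j -> A i j = 0 -> A j i = 0 ->
    braid_rule [:: (i, z1); (j, z2)] [:: (j, z2); (i, z1)]
| Rule3 i j z1 z2 z3 : i != j -> A i j = -1 -> A j i = -1 ->
    braid_rule [:: (i, z1); (j, z2); (i, z3)]
      [:: (j, max z3 (z2 - z1)); (i, z1 + z3); (j, - max (- z1) (z3 - z2))]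
| Rule4 i j z1 z2 z3 z4 : i != j -> A i j = -1 -> A j i = -2 ->
    braid_rule [:: (i, z1); (j, z2); (i, z3); (j, z4)]
      [:: (j, max z4 (max (z2 - 2 * z1) (2 * z3 - z2)));
          (i, max (z1 + z4) (max z3 (z1 - z2 + 2 * z3)));
          (j, - max (- z2) (max (- z4 - 2 * z1) (- (2 * z2) + 2 * z3 - z4)));
          (i, - max (- z3 + z4) (max (- z1) (z3 - z2)))]
| Rule4' i j z1 z2 z3 z4 : i != j -> A i j = -2 -> A j i = -1 ->
    braid_rule [:: (i, z1); (j, z2); (i, z3); (j, z4)]
      [:: (j, max (z3 - z2) (max (z2 - z1) z4));
          (i, max (z1 - 2 * z2 + 2 * z3) (max z3 (z1 + 2 * z4)));
          (j, - max (- (2 * z2) + z3 - z4) (max (- z1 - z4) (- z2)));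
          (i, - max (- (2 * z2) + z3) (max (- z1) (2 * z4 - z3)))].

Lemma braid_isoP u v : braid_iso A u = Some v <-> braid_rule u v.
Proof.
split; last first.
  case=> [i j z1 z2 ij E F|i j z1 z2 z3 ij E F|i j z1 z2 z3 z4 ij E F|i j z1 z2 z3 z4 ij E F];
  by rewrite /= ?eqxx ?ij E F.
case: u => [|[i z1] [|[j z2] [|[i' z3] [|[j' z4] [|]]]]] //=.
- case: ifP => // /andP[ij /eqP p] [<-].
  by case: HA => _ /(_ i j ij)[] [E F]; move: p; rewrite E F // => _; constructor.
- case: ifP => // /andP[/eqP-> /eqP p] [<-].
  have ij : i != j by apply: contraPneq p => ->; rewrite Aii.
  by case: HA => _ /(_ i j ij)[] [E F]; move: p; rewrite E F // => _; constructor.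
case: ifP => // /andP[/eqP-> /eqP->].
have [ij|ij] := eqVneq i j; first by rewrite ij Aii.
case: ifP => [/andP[/eqP E /eqP F] [<-]|_]; first by constructor.
by case: ifP => // /andP[/eqP E /eqP F] [<-]; constructor.
Qed.

(** The pairing of h_j with the weight of x. *)
Fixpoint hpair (j : 'I_n) (x : tensor) : int :=
  if x is (i, z) :: b then A j i * z + hpair j b else 0.

(** phi_j(x) <= c, where phi_j(x) is the maximum, over the factors (z)_j of x,
of z plus the pairing of h_j with the weight of what follows. A bound is used
instead of the maximum because x may have no factor with letter j. *)
Fixpoint phi_le (j : 'I_n) (x : tensor) (c : int) : bool :=
  if x is (i, z) :: b then ((i == j) ==> (z + hpair j b <= c)) && phi_le j b c
  else true.

(** y = e_j x and T = phi_j(x). By the tensor product rule e_j acts on the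
leftmost factor for which the maximum phi_j(x) is attained; the two bounds say
this about the factors on the right and, after subtraction of the weight of
(z)_j and b, strictly about those on the left. *)
Definition raises (j : 'I_n) (x y : tensor) (T : int) : Prop :=
  exists a z b, [/\ x = a ++ (j, z) :: b, y = a ++ (j, z + 1) :: b,
    T = z + hpair j b, phi_le j b T & phi_le j a (- z - 1)].

Lemma hpair_cat j a b : hpair j (a ++ b) = hpair j a + hpair j b.
Proof. by elim: a => [|[i z] a IH] /=; rewrite ?add0r // IH addrA. Qed.

Lemma phi_le_cat j a b c :
  phi_le j (a ++ b) c = phi_le j a (c - hpair j b) && phi_le j b c.
Proof.
by elim: a => [|[i z] a IH] //=; rewrite IH hpair_cat andbA lerBrDr addrA.
Qed.

Lemma braid_rule_hpair u v j : braid_rule u v -> hpair j u = hpair j v.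
Proof.
case=> [i k z1 z2 _ _ _|i k z1 z2 z3 _ _ _|i k z1 z2 z3 z4 _ _ _|i k z1 z2 z3 z4 _ _ _] /=.
- by ring.
- set y := max z3 _; set y' := max (- z1) _.
  have -> : y' = y - z2 by rewrite /y /y'; lia.
  by ring.
- set y1 := max z4 _; set y2 := max (z1 + z4) _.
  set y3 := max (- z2) _; set y4 := max (- z3 + z4) _.
  have -> : y3 = y1 - z2 - z4 by rewrite /y1 /y3; lia.
  have -> : y4 = y2 - z1 - z3 by rewrite /y2 /y4; lia.
  by ring.
- set y1 := max (z3 - z2) _; set y2 := max (z1 - 2 * z2 + 2 * z3) _.
  set y3 := max (- (2 * z2) + z3 - z4) _; set y4 := max (- (2 * z2) + z3) _.
  have -> : y3 = y1 - z2 - z4 by rewrite /y1 /y3; lia.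
  have -> : y4 = y2 - z1 - z3 by rewrite /y2 /y4; lia.
  by ring.
Qed.

Lemma braid_rule_phi u v j c : braid_rule u v -> phi_le j u c = phi_le j v c.
Proof.
case=> [i k z1 z2 ik E F|i k z1 z2 z3 ik E F|i k z1 z2 z3 z4 ik E F|i k z1 z2 z3 z4 ik E F] /=.
all: have ki : k != i by rewrite eq_sym.
all: have [ij|ij] := eqVneq i j; [subst j; rewrite ?(negbTE ki) ?eqxx ?Aii ?E ?F /=; lia|].
all: have [kj|kj] := eqVneq k j; [subst j; rewrite ?(negbTE ik) ?eqxx ?Aii ?E ?F /=; lia|by []].
Qed.

Lemma raises_consE j i z x y T : raises j ((i, z) :: x) y T ->
  [/\ i = j, y = (i, z + 1) :: x, T = z + hpair j x & phi_le j x T] \/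
  exists y', [/\ y = (i, z) :: y', raises j x y' T & (i == j) ==> (z < T - hpair j x)].
Proof.
move=> [[|[i' z'] a] [w [b [/= [-> -> ->] -> -> pb]]]]; first by move=> _; left.
move=> /andP[pi pa]; right; exists (a ++ (j, w + 1) :: b); split=> //; first by exists a, w, b.
rewrite hpair_cat /= Aii; apply/implyP => /(implyP pi); lia.
Qed.

Lemma raises_nil j y T : ~ raises j [::] y T.
Proof. by case=> [[|? ?]] [? [? []]]. Qed.

(** From a raised short tensor: one goal per factor on which e_j may act. *)
Ltac inv_raises := repeat match goal with
 | H : raises _ [::] _ _ |- _ => by case: (raises_nil H)
 | H : raises _ (_ :: _) _ _ |- _ =>
     let E := fresh "E" in let y := fresh "y" in let R := fresh "R" in
     case: (raises_consE H) => {H}[[E -> ? ?]|[y [-> R ?]]] end.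

Ltac norm ik ki E F :=
  repeat match goal with
  | H : is_true (phi_le _ _ _) |- _ =>
      progress rewrite /= ?eqxx ?(negbTE ki) ?(negbTE ik) ?E ?F ?Aii /= in H
  | H : is_true (_ ==> _) |- _ =>
      progress rewrite /= ?eqxx ?(negbTE ki) ?(negbTE ik) ?E ?F ?Aii /= in H
  end.
Ltac simp_lia ik ki E F :=
  rewrite /= ?eqxx ?(negbTE ki) ?(negbTE ik) ?E ?F ?Aii /=; lia.
Ltac check_raise ik ki E F := split;
  [reflexivity | do ?congr (_ :: _); congr (_, _); lia
  | simp_lia ik ki E F | simp_lia ik ki E F | simp_lia ik ki E F].

(** If the letter j occurs twice, at coordinates y1 and y3 around a letter k at
y2, the first occurrence attains the maximum exactly when y1 + a_jk y2 + y3 >= 0. *)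
Ltac choose_raise ik ki E F :=
  let c := fresh "c" in
  lazymatch goal with
  | |- raises ?j [:: (?j, _); (_, _)] _ _ => eexists [::], _, [:: (_, _)]
  | |- raises ?j [:: (_, _); (?j, _)] _ _ => eexists [:: (_, _)], _, [::]
  | |- raises ?j [:: (_, _); (?j, _); (_, _)] _ _ => eexists [:: (_, _)], _, [:: (_, _)]
  | |- raises ?j [:: (?j, ?y1); (?k, ?y2); (?j, ?y3)] _ _ =>
    case: (leP 0 (y1 + A j k * y2 + y3)) => [c|c]; rewrite ?E ?F in c;
    [eexists [::], _, [:: (_, _); (_, _)] | eexists [:: (_, _); (_, _)], _, [::]]
  | |- raises ?j [:: (?j, ?y1); (?k, ?y2); (?j, ?y3); (_, _)] _ _ =>
    case: (leP 0 (y1 + A j k * y2 + y3)) => [c|c]; rewrite ?E ?F in c;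
    [eexists [::], _, [:: (_, _); (_, _); (_, _)]
    |eexists [:: (_, _); (_, _)], _, [:: (_, _)]]
  | |- raises ?j [:: (_, _); (?j, ?y2); (?k, ?y3); (?j, ?y4)] _ _ =>
    case: (leP 0 (y2 + A j k * y3 + y4)) => [c|c]; rewrite ?E ?F in c;
    [eexists [:: (_, _)], _, [:: (_, _); (_, _)]
    |eexists [:: (_, _); (_, _); (_, _)], _, [::]]
  end.

(** Braid-type isomorphisms commute with e_j and preserve phi_j: for each
position on which e_j acts before the move, the position after the move is
found by comparing the two candidates, and what remains is piecewise linear
arithmetic. *)
Lemma braid_rule_raises u v u' j T : braid_rule u v -> raises j u u' T ->
  exists v', braid_rule u' v' /\ raises j v v' T.
Proof.
case=> [i k z1 z2 ik E F|i k z1 z2 z3 ik E F|i k z1 z2 z3 z4 ik E F|i k z1 z2 z3 z4 ik E F] r.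
all: have ki : k != i by rewrite eq_sym.
all: inv_raises; subst j T; norm ik ki E F; (eexists; split; [by constructor|]).
all: choose_raise ik ki E F; check_raise ik ki E F.
Qed.

End RankTwo.

(** * Braid moves inside a tensor *)

Section BraidMoves.

Variables (n : nat) (A : 'M[int]_n).
Hypothesis HA : cartan_like A.

Local Notation word := (seq 'I_n).
Local Notation tensor := (tensor n).

Let Aii i : A i i = 2. Proof. by case: HA. Qed.

Lemma raises_letters j x y T : raises A j x y T -> unzip1 y = unzip1 x.
Proof. by case=> a [z [b [-> -> _ _ _]]]; rewrite /unzip1 !map_cat. Qed.

Lemma raises_phi j x y T c : raises A j x y T -> phi_le A j x c -> T <= c.
Proof.
case=> a [z [b [-> _ -> _ _]]]; rewrite phi_le_cat => /andP[_] /=.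
by rewrite eqxx => /andP[].
Qed.

Lemma raises_fun j x y y' T T' : raises A j x y T -> raises A j x y' T' -> y = y'.
Proof.
elim: x y y' => [|[i z] x IH] y y'; first by move/raises_nil.
move=> /(raises_consE HA)[[ij -> ET pT]|[w [-> rw lw]]];
  move=> /(raises_consE HA)[[ij' -> ET' pT']|[w' [-> rw' lw']]] //.
- by have := raises_phi rw' pT; move: lw'; rewrite ij eqxx /=; lia.
- by have := raises_phi rw pT'; move: lw; rewrite ij' eqxx /=; lia.
- by rewrite (IH _ _ rw rw').
Qed.

Lemma raises_catl j x y y' T : raises A j x y' (T - hpair A j y) -> phi_le A j y T ->
  raises A j (x ++ y) (y' ++ y) T.
Proof.
case=> a [z [b [-> -> E pb pa]]] py; exists a, z, (b ++ y).
by rewrite -!catA hpair_cat phi_le_cat pb py; split=> //; rewrite addrA -E subrK.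
Qed.

Lemma raises_catr j x y y' T : raises A j y y' T ->
  phi_le A j x (T - hpair A j y - 1) -> raises A j (x ++ y) (x ++ y') T.
Proof.
case=> a [z [b [-> -> E pb pa]]] px; exists (x ++ a), z, b.
rewrite -!catA phi_le_cat pa andbT; split=> //.
by move: px; rewrite E hpair_cat /= Aii; congr phi_le; lia.
Qed.

(** The tensor product rule; with raises_catl and raises_catr it reduces the
action of e_j around a braid move to the factors that are moved. *)
Lemma raises_catP j x y w T : raises A j (x ++ y) w T ->
  (exists x', [/\ w = x' ++ y, raises A j x x' (T - hpair A j y) & phi_le A j y T]) \/
  (exists y', [/\ w = x ++ y', raises A j y y' T & phi_le A j x (T - hpair A j y - 1)]).
Proof.
elim: x w => [|[i z] x IH] w; first by move=> r; right; exists w.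
rewrite cat_cons => /(raises_consE HA)[[ij -> -> ]|[v [-> rv lv]]].
  rewrite phi_le_cat hpair_cat => /andP[px py]; left.
  exists ((i, z + 1) :: x); split=> //; exists [::], z, x; rewrite ij; split=> //.
    by rewrite addrA addrK.
rewrite hpair_cat in lv.
have [[x' [-> rx py]]|[y' [-> ry px]]] := IH _ rv.
  left; exists ((i, z) :: x'); split=> //.
  have [a [w' [b [Ex -> E pb pa]]]] := rx.
  exists ((i, z) :: a), w', b; split=> //; first by rewrite Ex.
  rewrite /= pa andbT; apply/implyP => /(implyP lv).
  by rewrite Ex hpair_cat /= Aii; lia.
right; exists y'; split=> //=; rewrite px andbT.
by apply/implyP => /(implyP lv); lia.
Qed.

Lemma braid_rule_size u v : braid_rule A u v -> size v = size u.
Proof. by case. Qed.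

Lemma braid_rule_letters u v u0 : braid_rule A u v -> unzip1 u0 = unzip1 u ->
  exists v0, braid_rule A u0 v0 /\ unzip1 v0 = unzip1 v.
Proof.
case=> [i k z1 z2 ik E F|i k z1 z2 z3 ik E F|i k z1 z2 z3 z4 ik E F|i k z1 z2 z3 z4 ik E F];
case: u0 => [|[? ?] [|[? ?] [|[? ?] [|[? ?] [|[? ?] ?]]]]] //= [*]; subst;
by eexists; split; [constructor|].
Qed.

(** The last clause allows one move to be replayed on another tensor with
factors of the same sizes; this is how a move is followed through e_j, a
translation or a change of coordinates. *)
Lemma braid_moveP km x y : braid_move A km x = Some y ->
  exists l u v r, [/\ x = l ++ u ++ r, y = l ++ v ++ r, braid_rule A u v &
    forall l' u' v' r', size l' = size l -> size u' = size u -> size r' = size r ->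
      braid_rule A u' v' -> braid_move A km (l' ++ u' ++ r') = Some (l' ++ v' ++ r')].
Proof.
case: km => k m /=; set u := take m (drop k x).
case Ev: (braid_iso A u) => [v|] //= [<-].
have ruv : braid_rule A u v by apply/(braid_isoP HA).
have uN : (0 < size u)%N by case: ruv.
have kx : (k < size x)%N.
  rewrite ltnNge; apply/negP => xk; move: uN; by rewrite /u drop_oversize.
have Er : drop (k + m) x = drop m (drop k x) by rewrite drop_drop addnC.
exists (take k x), u, v, (drop (k + m) x); split=> //.
  by rewrite Er /u !cat_take_drop.
move=> l' u' v' r'; rewrite size_takel ?(ltnW kx) // => sl su sr /(braid_isoP HA) E'.
have dk : drop k (l' ++ u' ++ r') = u' ++ r' by rewrite -sl drop_size_cat.
have tk : take k (l' ++ u' ++ r') = l' by rewrite -sl take_size_cat.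
have [tm dm] : take m (u' ++ r') = u' /\ drop m (u' ++ r') = r'.
  have [mu|um] := leqP (size (drop k x)) m.
    have r0 : r' = [::].
      by apply/nilP; rewrite /nilp sr Er size_drop; apply/eqP; lia.
    rewrite r0 cats0 take_oversize ?drop_oversize // su /u;
    by rewrite size_take_min geq_minl.
  have Su' : size u' = m by rewrite su /u size_takel // ltnW.
  by rewrite -Su' take_size_cat // drop_size_cat.
by rewrite tk dk tm E' /= addnC -drop_drop dk dm.
Qed.

Lemma size_raises j x y T : raises A j x y T -> size y = size x.
Proof. by case=> a [z [b [-> -> _ _ _]]]; rewrite !size_cat. Qed.

Lemma braid_move_raises km j x x' y T : raises A j x x' T ->
  braid_move A km x = Some y ->
  exists y', braid_move A km x' = Some y' /\ raises A j y y' T.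
Proof.
move=> rx /braid_moveP[l [u [v [r [Ex -> uv mv]]]]]; rewrite {}Ex in rx.
have suv := braid_rule_size uv; have huv := braid_rule_hpair j uv.
have puv c := braid_rule_phi HA j c uv.
case: (raises_catP rx) => [[l' [-> rl pl]]|[w [-> rw pl]]].
  exists (l' ++ v ++ r); rewrite (mv _ _ v) ?(size_raises rl) //; split=> //.
  by apply: raises_catl; move: rl pl; rewrite !hpair_cat !phi_le_cat huv puv.
rewrite !hpair_cat huv in pl.
case: (raises_catP rw) => [[u' [-> ru pu]]|[r' [-> rr pu]]].
  have [v' [uv' rv]] := braid_rule_raises HA uv ru.
  exists (l ++ v' ++ r); rewrite (mv _ _ v') ?(size_raises ru) //; split=> //.
  by apply: raises_catr; rewrite ?hpair_cat //; apply: raises_catl.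
exists (l ++ v ++ r'); rewrite (mv _ _ v) ?(size_raises rr) //; split=> //.
apply: raises_catr; rewrite ?hpair_cat //; apply: raises_catr => //.
by rewrite -puv.
Qed.

Lemma size_eq_letters (x y : tensor) : unzip1 x = unzip1 y -> size x = size y.
Proof. by move/(congr1 size); rewrite !size_map. Qed.

Lemma braid_move_letters km x x' y : unzip1 x' = unzip1 x -> braid_move A km x = Some y ->
  exists y', braid_move A km x' = Some y' /\ unzip1 y' = unzip1 y.
Proof.
move=> Exx /braid_moveP[l [u [v [r [Ex -> uv mv]]]]].
have S := size_eq_letters Exx.
rewrite -(cat_take_drop (size l) x') -(cat_take_drop (size u) (drop (size l) x')).
have Sx : size x' = (size l + (size u + size r))%N by rewrite S Ex !size_cat.
set l' := take _ x'; set u' := take _ _; set r' := drop _ _.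
have Sl : size l' = size l by rewrite /l' size_takel // Sx; lia.
have Su : size u' = size u by rewrite /u' size_takel // size_drop Sx; lia.
have Sr : size r' = size r by rewrite /r' !size_drop Sx; lia.
move: Exx; rewrite -(cat_take_drop (size l) x') -(cat_take_drop (size u) (drop (size l) x')).
rewrite -/l' -/u' -/r' Ex /unzip1 !map_cat => /eqP.
rewrite !eqseq_cat ?size_map // => /and3P[/eqP El /eqP Eu /eqP Er].
have [v' [uv' Ev]] := braid_rule_letters uv Eu.
exists (l' ++ v' ++ r'); rewrite (mv _ _ v') //; split=> //.
by rewrite !map_cat El Er; congr (_ ++ (_ ++ _)).
Qed.

(** Weights are given by their pairings with the coroots h_k. *)
Definition weight_refl (i : 'I_n) (la : {ffun 'I_n -> int}) : {ffun 'I_n -> int} :=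
  [ffun k => la k - A k i * la i].

Definition weight_act (s : word) (la : {ffun 'I_n -> int}) : {ffun 'I_n -> int} :=
  foldr weight_refl la s.

(** The coordinate at a letter i followed by the word t is increased by
<h_i, t la>. Up to sign this adds the coordinates of the extremal vectors of the
crystal of highest weight la; like these vectors, the translation is compatible
with braid moves. *)
Fixpoint shift (la : {ffun 'I_n -> int}) (x : tensor) : tensor :=
  if x is (i, z) :: b then (i, z + weight_act (unzip1 b) la i) :: shift la b else [::].

Lemma shift_letters la x : unzip1 (shift la x) = unzip1 x.
Proof. by elim: x => [|[i z] x IH] //=; rewrite IH. Qed.

Lemma shift_cat la x y :
  shift la (x ++ y) = shift (weight_act (unzip1 y) la) x ++ shift la y.
Proof.
by elim: x => [|[i z] x IH] //=; rewrite IH /unzip1 map_cat /weight_act foldr_cat.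
Qed.

Lemma size_shift la x : size (shift la x) = size x.
Proof. exact/size_eq_letters/shift_letters. Qed.

Lemma shift_inj la x y : unzip1 x = unzip1 y -> shift la x = shift la y -> x = y.
Proof.
elim: x y => [|[i z] x IH] [|[k w] y] //= [-> Exy] [].
by rewrite Exy => /addIr -> /(IH _ Exy) ->.
Qed.

Lemma braid_rule_weight_act u v la : braid_rule A u v ->
  weight_act (unzip1 u) la = weight_act (unzip1 v) la.
Proof.
case=> [i k z1 z2 ik E F|i k z1 z2 z3 ik E F|i k z1 z2 z3 z4 ik E F|i k z1 z2 z3 z4 ik E F];
by apply/ffunP => l; rewrite /= !ffunE ?Aii ?E ?F; ring.
Qed.

Lemma braid_rule_eq u v v' : braid_rule A u v -> v = v' -> braid_rule A u v'.
Proof. by move=> uv <-. Qed.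

Lemma braid_rule_shift u v la : braid_rule A u v ->
  braid_rule A (shift la u) (shift la v).
Proof.
case=> [i k z1 z2 ik E F|i k z1 z2 z3 ik E F|i k z1 z2 z3 z4 ik E F|i k z1 z2 z3 z4 ik E F];
rewrite /= !ffunE ?Aii ?E ?F; (apply: braid_rule_eq; [by constructor|]);
by do ?congr (_ :: _); congr (_, _); lia.
Qed.

Lemma braid_move_shift km x y la : braid_move A km x = Some y ->
  braid_move A km (shift la x) = Some (shift la y).
Proof.
move=> /braid_moveP[l [u [v [r [-> -> uv mv]]]]].
rewrite !shift_cat (mv _ _ (shift (weight_act (unzip1 r) la) v)) ?size_shift //;
  last exact: braid_rule_shift.
congr (Some (shift _ _ ++ _)).
by rewrite /unzip1 !map_cat /weight_act !foldr_cat; exact: braid_rule_weight_act.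
Qed.

Definition zeros (x : tensor) : bool := all (fun b => b.2 == 0) x.

Lemma zerosP x : zeros x -> x = cellular_zero (unzip1 x).
Proof. by elim: x => [|[i z] x IH] //= /andP[/eqP/= -> /IH {1}->]. Qed.

Lemma zeros_cellular s : zeros (cellular_zero s).
Proof. by elim: s => //= i s ->; rewrite eqxx. Qed.

Lemma braid_move_zeros km x y : braid_move A km x = Some y -> zeros x -> zeros y.
Proof.
move=> /braid_moveP[l [u [v [r [-> -> uv _]]]]]; rewrite /zeros !all_cat.
case/and3P=> -> pu ->; rewrite andbT /=; move: pu.
case: uv => [i k z1 z2 _ _ _|i k z1 z2 z3 _ _ _|i k z1 z2 z3 z4 _ _ _|i k z1 z2 z3 z4 _ _ _];
by rewrite /=; lia.
Qed.

Lemma braid_moves_cat p q x :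
  braid_moves A (p ++ q) x = obind (braid_moves A q) (braid_moves A p x).
Proof. by elim: p x => //= km p IH x; case: braid_move => //= y; rewrite IH. Qed.

Lemma braid_moves_raises p j x x' y T : raises A j x x' T ->
  braid_moves A p x = Some y ->
  exists y', braid_moves A p x' = Some y' /\ raises A j y y' T.
Proof.
elim: p x x' => [|km p IH] x x' rx /=; first by case=> <-; exists x'.
case E: braid_move => [w|] //=; have [w' [-> rw]] := braid_move_raises rx E.
exact: IH.
Qed.

Lemma braid_moves_letters p x x' y : unzip1 x' = unzip1 x -> braid_moves A p x = Some y ->
  exists y', braid_moves A p x' = Some y' /\ unzip1 y' = unzip1 y.
Proof.
elim: p x x' => [|km p IH] x x' Ex /=; first by case=> <-; exists x'.
case E: braid_move => [w|] //=; have [w' [-> Ew]] := braid_move_letters Ex E.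
exact: IH.
Qed.

Lemma braid_moves_shift p x y la : braid_moves A p x = Some y ->
  braid_moves A p (shift la x) = Some (shift la y).
Proof.
elim: p x => [|km p IH] x /=; first by case=> <-.
by case E: braid_move => [w|] //=; rewrite (braid_move_shift la E) /=; apply: IH.
Qed.

Lemma braid_moves_zeros p x y : braid_moves A p x = Some y -> zeros x -> zeros y.
Proof.
elim: p x => [|km p IH] x /=; first by case=> <-.
by case E: braid_move => [w|] //= /IH H /(braid_move_zeros E).
Qed.

Lemma alt_braid_rule (i j : 'I_n) x : i != j -> unzip1 x = alt (bond A i j) i j ->
  exists y, braid_rule A x y /\ unzip1 y = alt (bond A i j) j i.
Proof.
move=> ij; have ji : j != i by rewrite eq_sym.
case: (HA) => _ /(_ i j ij).
case: x => [|[? ?] [|[? ?] [|[? ?] [|[? ?] [|[? ?] ?]]]]] /= [[E F]|[E F]|[E F]|[E F]];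
  rewrite /bond E F //= => -[*]; subst; by eexists; split; [constructor|].
Qed.

Lemma split_letters (x : tensor) s t : unzip1 x = s ++ t ->
  exists x1 x2, [/\ x = x1 ++ x2, unzip1 x1 = s & unzip1 x2 = t].
Proof.
move=> Ex; exists (take (size s) x), (drop (size s) x).
split; first by rewrite cat_take_drop.
  by rewrite /unzip1 map_take -/(unzip1 x) Ex take_size_cat.
by rewrite /unzip1 map_drop -/(unzip1 x) Ex drop_size_cat.
Qed.

Lemma split_rcons (x : tensor) s i : unzip1 x = rcons s i ->
  exists y z, x = rcons y (i, z) /\ unzip1 y = s.
Proof.
case/lastP: x => [|y [k z]]; first by case: s.
by rewrite /unzip1 map_rcons => /rcons_inj[<- ->]; exists y, z.
Qed.

Lemma braid_move_mid a u v b : braid_rule A u v ->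
  braid_move A (size a, size u) (a ++ u ++ b) = Some (a ++ v ++ b).
Proof.
move=> /(braid_isoP HA) E.
rewrite /= (@drop_size_cat _ (size a)) // !take_size_cat // E /= (catA a u) -size_cat.
by rewrite drop_size_cat.
Qed.

(** Words equivalent under braid relations are joined by moves that can be
carried out inside any tensor, at a given position k and whatever the
coordinates are. *)
Lemma braid_eqv_moves s t k : braid_eqv A s t -> exists p, forall a x b, size a = k ->
  unzip1 x = s ->
  exists y, unzip1 y = t /\ braid_moves A p (a ++ x ++ b) = Some (a ++ y ++ b).
Proof.
elim=> [u|a' b' i j u ij _ [p IH]]; first by exists [::] => a x b _ Ex; exists x.
exists ((k + size a', bond A i j)%N :: p) => a x b Sa Ex.
have [l [w [-> El /split_letters[v [r [-> Ev Er]]]]]] := split_letters Ex.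
have [v' [vv' Ev']] := alt_braid_rule ij Ev.
have [|y [Ey py]] := IH a (l ++ v' ++ r) b Sa.
  by rewrite /unzip1 !map_cat -/(unzip1 l) El -/(unzip1 r) Er -Ev'.
exists y; split=> //; rewrite -py.
have := braid_move_mid (a ++ l) (r ++ b) vv'.
rewrite size_cat Sa -(size_map (@fst _ _) l) -(size_map (@fst _ _) v) -/(unzip1 l) -/(unzip1 v).
by rewrite El Ev size_alt -!catA /= => ->.
Qed.
End BraidMoves.

(** * Positivity *)

Section Positivity.

Variables (n : nat) (A : 'M[int]_n).
Hypothesis HA : cartan_like A.

Local Notation word := (seq 'I_n).
Local Notation W := (word_elt A).
Local Notation tensor := (tensor n).

Definition last_nonneg (x : tensor) : bool := 0 <= last 0 (unzip2 x).

Definition all_nonneg (x : tensor) : bool := all (fun b => 0 <= b.2) x.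

Definition ends_nonneg (p : seq (nat * nat)) (x : tensor) : Prop :=
  forall y, braid_moves A p x = Some y -> last_nonneg y.

Lemma last_nonneg_rcons x i z : last_nonneg (rcons x (i, z)) = (0 <= z).
Proof. by rewrite /last_nonneg /unzip2 map_rcons last_rcons. Qed.

Lemma braid_moves1 km x : braid_moves A [:: km] x = braid_move A km x.
Proof. by rewrite /braid_moves; case: (braid_move A km x). Qed.

Lemma ends_nonneg_cat p q x y :
  ends_nonneg (p ++ q) x -> braid_moves A p x = Some y -> ends_nonneg q y.
Proof. by move=> g Ey w Ew; apply: g; rewrite braid_moves_cat Ey. Qed.

Lemma braid_rule_nonneg u v : braid_rule A u v -> last_nonneg u -> last_nonneg v ->
  all_nonneg u.
Proof.
case=> [i k z1 z2 _ _ _|i k z1 z2 z3 _ _ _|i k z1 z2 z3 z4 _ _ _|i k z1 z2 z3 z4 _ _ _];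
by rewrite /last_nonneg /all_nonneg /=; lia.
Qed.

(** The minimal coset representative u can be followed by any reduced word of
the dihedral subgroup, in particular by the longest word that begins with the
given alternating word. *)
Lemma extend_alt u k i j : i != j -> (k <= bond A i j)%N ->
  reduced A (u ++ alt k i j) -> ~ descent A u i -> ~ descent A u j ->
  exists (a b : 'I_n) r, [/\ a != b, bond A a b = bond A i j,
    alt (bond A a b) a b = alt k i j ++ r & reduced A (u ++ alt (bond A a b) a b)].
Proof.
move Ed: (bond A i j - k)%N => d; elim: d => [|d IH] in k i j Ed *.
  move=> ij kb r _ _; exists i, j, [::].
  have Ek : bond A i j = k by apply/eqP; rewrite eqn_leq kb -subn_eq0 Ed eqxx.
  by rewrite cats0 Ek.
move=> ij kb ru ndi ndj.
have ji : j != i by rewrite eq_sym.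
have [|||//|//|a [b [r [ab Eb E R]]]] := IH k.+1 j i _ ji.
- by rewrite (bondC A j i); lia.
- by rewrite (bondC A j i); lia.
- rewrite /= -rcons_cat; apply: nonneg_reduced_rcons => //.
  have kb' : (k < bond A i j)%N by lia.
  have [c [e [c0 e0 E]]] := alt_root HA ij kb'.
  have ru' := reduced_catl ru.
  by rewrite word_elt_cat -mulmxA E; apply: nonneg_comb => //; apply: nonneg_root.
by exists a, b, (i :: r); split=> //; [rewrite Eb bondC | rewrite -cat_rcons].
Qed.

(** The factor at j is brought inside a block on the longest word of a dihedral
subgroup. Fewer than size v letters follow this block, so the induction on the
number of letters on the right controls its last coordinate, both before and
after the braid move on the block; braid_rule_nonneg concludes. *)
Lemma coord_nonneg v u j : longest A (u ++ j :: v) ->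
  exists P : seq (seq (nat * nat)), forall xu z xv, unzip1 xu = u -> unzip1 xv = v ->
    (forall p, p \in P -> ends_nonneg p (xu ++ (j, z) :: xv)) -> 0 <= z.
Proof.
elim: {v}_.+1 {-2}v u j (ltnSn (size v)) => // N IH v u j vN Ls.
case: v vN Ls => [|i v] vN Ls.
  exists [:: [::]] => xu z [] // _ _ /(_ [::]); rewrite inE eqxx => /(_ isT _ erefl).
  by rewrite cats1 last_nonneg_rcons.
have [Rs _] := Ls.
have Ruji : reduced A (rcons (rcons u j) i).
  by apply: (@reduced_catl _ _ _ v); rewrite !cat_rcons.
have ndi := reduced_rcons_descent HA Ruji.
have Ruj : reduced A (rcons u j) by move: Ruji; rewrite -cats1 => /reduced_catl.
have Ru : reduced A u by move: Ruj; rewrite -cats1 => /reduced_catl.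
have ij : i != j by apply/eqP => ij; apply: ndi; rewrite ij; exact: descent_rcons.
have Ruj' : reduced A (u ++ alt 1 i j) by rewrite cats1.
(* The alternating word ends with the letter j whose coordinate is studied;
   only the letters before it are moved. *)
have [u' [[|k] [// _ Eu Su ndui nduj]]] := dihedral_factor HA Ruj'.
rewrite cats1 in Eu; rewrite addnS addn1 in Su; case: Su => Su.
have Suk : size (u' ++ alt k.+1 i j) = size (rcons u j).
  by rewrite size_cat size_alt size_rcons addnS Su.
have kb : (k.+1 < bond A i j)%N.
  rewrite ltnNge; apply/negP => bk; apply: ndi.
  exact: descent_eq Eu Suk (alt_descent HA u' ij bk).
have Ruk : reduced A (u' ++ alt k.+1 i j) by apply: reduced_eq Ruj Eu Suk.
(* The letters r complete the alternating word to the longest one;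
   i :: v is replaced by r ++ v'. *)
have [a [b [r [ab Eab Er Rab]]]] := extend_alt ij (ltnW kb) Ruk ndui nduj.
have [v' [Ev' Sv']] := longest_extr HA Ls Rab.
have EuM : braid_eqv A u (u' ++ alt k j i).
  apply: (matsumoto HA Ru); last by rewrite size_cat size_alt.
  by apply: (@word_elt_rcons_inj _ _ HA _ _ j); rewrite rcons_cat -Eu.
have Sr : (size r + size v' = (size v).+1)%N.
  move: Sv'; rewrite Er !size_cat !size_alt /=; lia.
have EvM : braid_eqv A (i :: v) (r ++ v').
  apply: matsumoto => //; last by rewrite size_cat Sr.
    by apply: (@reduced_catr _ _ (rcons u j)); rewrite cat_rcons.
  apply: (@word_elt_cat_inj _ _ HA (rcons u j)); rewrite cat_rcons -Ev' Er.
  by rewrite !(word_elt_cat A (rcons u j)) -Eu !word_elt_cat !mulmxA.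
have r0 : (0 < size r)%N.
  by have := congr1 size Er; rewrite size_cat !size_alt Eab; lia.
have v'N : (size v' < N)%N by move: vN => /=; lia.
have [m Em] : exists m, bond A a b = m.+1.
  by exists (k + size r)%N; have := congr1 size Er; rewrite size_cat !size_alt.
have [P1 HP1] : exists P : seq (seq (nat * nat)), forall xu z xv,
    unzip1 xu = u' ++ alt m b a -> unzip1 xv = v' ->
    (forall p, p \in P -> ends_nonneg p (xu ++ (b, z) :: xv)) -> 0 <= z.
  have EL : (u' ++ alt m b a) ++ b :: v' = (u' ++ alt (bond A a b) a b) ++ v'.
    by rewrite Em -cat_rcons rcons_cat.
  by apply: IH => //; apply: longest_eq Ls _ _; rewrite EL // size_cat Sv'.
have [P2 HP2] : exists P : seq (seq (nat * nat)), forall xu z xv,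
    unzip1 xu = u' ++ alt m a b -> unzip1 xv = v' ->
    (forall p, p \in P -> ends_nonneg p (xu ++ (a, z) :: xv)) -> 0 <= z.
  have Eba := alt_braid HA ab; rewrite Em in Eba.
  have EL : (u' ++ alt m a b) ++ a :: v' = (u' ++ alt m.+1 b a) ++ v'.
    by rewrite -cat_rcons rcons_cat.
  apply: IH => //; apply: longest_eq Ls _ _; rewrite EL.
    by rewrite -Ev' Em !word_elt_cat Eba.
  by rewrite -Sv' Em !size_cat !size_alt.
have [p1 Hp1] := braid_eqv_moves HA 0 EuM.
have [p2 Hp2] := braid_eqv_moves HA (size u).+1 EvM.
exists ([seq p1 ++ p2 ++ q | q <- P1] ++
        [seq p1 ++ p2 ++ (size u', bond A a b) :: q | q <- P2]) => xu z xv Exu Exv nonneg12.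
have [yu [Eyu Myu]] := Hp1 [::] xu ((j, z) :: xv) erefl Exu.
have [|yv [Eyv Myv]] := Hp2 (yu ++ [:: (j, z)]) xv [::] _ Exv.
  rewrite size_cat addn1 -(size_map (@fst _ _) yu) -/(unzip1 yu) Eyu.
  by rewrite size_cat size_alt Su.
rewrite !cats0 -!catA /= in Myv Myu.
have [y1 [y2 [Ey Ey1 Ey2]]] := split_letters Eyu.
have [y3 [y4 [Ey' Ey3 Ey4]]] := split_letters Eyv.
(* The block d on the longest dihedral word contains the factor (z)_j. *)
set d := y2 ++ (j, z) :: y3.
have Ed : unzip1 d = alt (bond A a b) a b.
  by rewrite /d /unzip1 map_cat /= -/(unzip1 y2) -/(unzip1 y3) Ey2 Ey3 Er /= cat_rcons.
have EX : yu ++ (j, z) :: yv = y1 ++ d ++ y4 by rewrite Ey Ey' /d -!catA.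
have [d' [dd' Ed']] := alt_braid_rule HA ab Ed.
have Sd : size d = bond A a b by rewrite -(size_map (@fst _ _)) -/(unzip1 d) Ed size_alt.
have S1 : size y1 = size u' by rewrite -(size_map (@fst _ _)) -/(unzip1 y1) Ey1.
have Md := braid_move_mid HA y1 y4 dd'; rewrite S1 Sd -EX in Md.
have ld : last_nonneg d.
  move: Ed; rewrite Em -[alt _ _ _]/(rcons (alt m b a) b).
  case/split_rcons=> d1 [zb [Ed0 Ed1]].
  rewrite Ed0 last_nonneg_rcons; apply: (HP1 (y1 ++ d1) zb y4) => //.
    by rewrite /unzip1 map_cat -/(unzip1 y1) -/(unzip1 d1) Ey1 Ed1.
  move=> q qP; have -> : (y1 ++ d1) ++ (b, zb) :: y4 = yu ++ (j, z) :: yv.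
    by rewrite EX Ed0 cat_rcons -catA.
  apply: ends_nonneg_cat Myv; apply: ends_nonneg_cat Myu; apply: nonneg12.
  by rewrite mem_cat (map_f (fun q => p1 ++ p2 ++ q)).
have ld' : last_nonneg d'.
  move: Ed'; rewrite Em -[alt _ _ _]/(rcons (alt m a b) a).
  case/split_rcons=> d1 [zb [Ed0 Ed1]].
  rewrite Ed0 last_nonneg_rcons; apply: (HP2 (y1 ++ d1) zb y4) => //.
    by rewrite /unzip1 map_cat -/(unzip1 y1) -/(unzip1 d1) Ey1 Ed1.
  move=> q qP; have -> : (y1 ++ d1) ++ (a, zb) :: y4 = y1 ++ d' ++ y4.
    by rewrite Ed0 cat_rcons -catA.
  have Md' : braid_moves A [:: (size u', bond A a b)] (yu ++ (j, z) :: yv)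
      = Some (y1 ++ d' ++ y4).
    by rewrite braid_moves1 Md.
  apply: ends_nonneg_cat Md'; apply: ends_nonneg_cat Myv.
  apply: ends_nonneg_cat Myu; apply: nonneg12.
  by rewrite mem_cat (map_f (fun q => p1 ++ p2 ++ (size u', bond A a b) :: q)) ?orbT.
have := braid_rule_nonneg dd' ld ld'.
by rewrite /all_nonneg /d all_cat /= => /and3P[].
Qed.

Lemma coords_nonneg s : longest A s ->
  exists P : seq (seq (nat * nat)), forall x, unzip1 x = s ->
    (forall p, p \in P -> ends_nonneg p x) -> all_nonneg x.
Proof.
move=> Ls.
suff H u v : u ++ v = s -> exists P : seq (seq (nat * nat)), forall x y,
    unzip1 x = u -> unzip1 y = v -> (forall p, p \in P -> ends_nonneg p (x ++ y)) -> all_nonneg x.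
  have [P HP] := H s [::] (cats0 s).
  by exists P => x Ex g; apply: (HP x [::]) => // p /g; rewrite cats0.
elim/last_ind: u v => [|u j IH] v Euv; first by exists [::] => -[].
rewrite cat_rcons in Euv; have [P1 H1] := IH _ Euv.
have [P2 H2] : exists P : seq (seq (nat * nat)), forall xu z xv, unzip1 xu = u -> unzip1 xv = v ->
    (forall p, p \in P -> ends_nonneg p (xu ++ (j, z) :: xv)) -> 0 <= z.
  by apply: coord_nonneg; rewrite Euv.
exists (P1 ++ P2) => x y /split_rcons[x1 [z [-> E1]]] Ey g.
rewrite cat_rcons in g; rewrite /all_nonneg all_rcons /= andbC; apply/andP; split.
  apply: (H1 _ ((j, z) :: y)) => //=; first by rewrite -/(unzip1 y) Ey.
  by move=> p pP; apply: g; rewrite mem_cat pP.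
by apply: (H2 x1 z y) => // p pP; apply: g; rewrite mem_cat pP orbT.
Qed.
End Positivity.

(** * Independence of the braid moves *)

Section PathIndependence.

Variables (n : nat) (A : 'M[int]_n).
Hypothesis HA : cartan_like A.

Local Notation word := (seq 'I_n).
Local Notation W := (word_elt A).
Local Notation tensor := (tensor n).
Local Notation max := Num.max.

Let Aii i : A i i = 2. Proof. by case: HA. Qed.

Lemma phi_le_mono j x c c' : phi_le A j x c -> c <= c' -> phi_le A j x c'.
Proof.
move=> px cc; elim: x px => [|[i z] x IH] //= /andP[pi /IH ->]; rewrite andbT.
by apply/implyP => /(implyP pi) /le_trans; apply.
Qed.

(** f_j x is defined as soon as the letter j occurs in x: it lowers the
rightmost factor at which phi_j(x) = T + 1 is attained. *)
Lemma exists_lower j x : (forall c, phi_le A j x c) \/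
  exists y T, raises A j y x T /\ phi_le A j x (T + 1).
Proof.
elim: x => [|[i z] x IH]; first by left.
have head : i = j -> phi_le A j x (z + hpair A j x) -> phi_le A j x (z - 1 + hpair A j x) ->
    exists y T, raises A j y ((i, z) :: x) T /\ phi_le A j ((i, z) :: x) (T + 1).
  move=> -> p p'; exists ((j, z - 1) :: x), (z - 1 + hpair A j x); split.
    by exists [::], (z - 1), x; rewrite subrK.
  by rewrite /= addrAC subrK p andbT lexx implybT.
case: IH => [px|[y [T [ryx px]]]].
  have [ij|ij] := eqVneq i j; first by right; apply: head.
  by left => c /=; rewrite (negbTE ij) px.
right; have [ij|ij] := eqVneq i j; last first.
  exists ((i, z) :: y), T; rewrite /= (negbTE ij); split=> //.
  by apply: (@raises_catr _ _ HA _ [:: (i, z)] _ _ _ ryx); rewrite /= (negbTE ij).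
have [zT|Tz] := leP (z + hpair A j x) (T + 1); last first.
  by apply: head => //; apply: (phi_le_mono px); lia.
have hyx : hpair A j x = hpair A j y + 2.
  by case: ryx => a [w [b [-> -> _ _ _]]]; rewrite !hpair_cat /= Aii; lia.
exists ((i, z) :: y), T; split; last by rewrite /= px zT implybT.
apply: (@raises_catr _ _ HA _ [:: (i, z)] _ _ _ ryx).
by rewrite /= andbT; apply/implyP => _; lia.
Qed.

Lemma exists_last_nonzero (x : tensor) : ~~ zeros x ->
  exists a j z b, [/\ x = a ++ (j, z) :: b, z != 0 & zeros b].
Proof.
elim: x => [|[i z] x IH] //=; have [zx|/IH[a [j [w [b [-> w0 zb]]]]] _] := boolP (zeros x).
  by rewrite andbT => z0; exists [::], i, z, x.
by exists ((i, z) :: a), j, w, b.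
Qed.

Lemma hpair_zeros j b : zeros b -> hpair A j b = 0.
Proof. by elim: b => [|[i z] b IH] //= /andP[/eqP/= -> /IH->]; rewrite mulr0. Qed.

(** The last nonzero coordinate z, at a letter j, is a lower bound of phi_j(x)
because only zeros follow it; so phi_j(x) > 0 and f_j can be applied. *)
Lemma nonneg_lower x : all_nonneg x -> ~~ zeros x ->
  exists j y T, raises A j y x T /\ 0 <= T.
Proof.
move=> px /exists_last_nonzero[a [j [z [b [Ex z0 zb]]]]].
have z1 : 0 < z by move: px; rewrite lt_def z0 Ex /all_nonneg all_cat => /and3P[].
have phi c : phi_le A j x c -> z <= c.
  by rewrite Ex phi_le_cat /= eqxx hpair_zeros // !addr0 /= => /and3P[].
case: (exists_lower j x) => [/(_ 0)/phi|[y [T [r /phi zT]]]]; first by lia.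
by exists j, y, T; split=> //; lia.
Qed.

Definition total (x : tensor) : int := \sum_(b <- x) b.2.

Lemma raises_total j x y T : raises A j x y T -> total y = total x + 1.
Proof.
case=> a [z [b [-> -> _ _ _]]]; rewrite /total !big_cat !big_cons /=; lia.
Qed.

Lemma total_ge0 x : all_nonneg x -> 0 <= total x.
Proof. by move/allP=> px; rewrite /total big_seq sumr_ge0. Qed.

(** If e_j acts on the last coordinate of x, that coordinate is phi_j(x). *)
Lemma raises_last j x y T : raises A j x y T -> 0 <= T -> last_nonneg y -> last_nonneg x.
Proof.
case=> a [z [b [-> -> ET _ _]]]; rewrite ET /last_nonneg /unzip2 !map_cat !last_cat.
by case: b ET => [|b0 b] //= _; rewrite addr0.
Qed.

(** Induction on the sum of the coordinates: f_j x satisfies the same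
inequalities (raises_last), so the two paths agree on it, and they commute with
e_j. *)
Lemma nonneg_paths_agree s (P : seq (seq (nat * nat))) : (forall x, unzip1 x = s ->
    (forall p, p \in P -> ends_nonneg A p x) -> all_nonneg x) ->
  forall p q x y y', unzip1 x = s -> (forall p, p \in P -> ends_nonneg A p x) ->
    braid_moves A p x = Some y -> braid_moves A q x = Some y' ->
    unzip1 y = unzip1 y' -> y = y'.
Proof.
move=> HP p q x y y' Ex nx; have [N tN] : exists N : nat, total x < N%:Z.
  by exists `|total x|.+1%N; lia.
elim: N x y y' Ex nx tN => [|N IH] x y y' Ex nx tN py qy Eyy.
  by have := total_ge0 (HP x Ex nx); lia.
have [zx|nzx] := boolP (zeros x).
  rewrite (zerosP (braid_moves_zeros HA py zx)) Eyy.
  by rewrite -(zerosP (braid_moves_zeros HA qy zx)).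
have [j [x0 [T [rx T0]]]] := nonneg_lower (HP x Ex nx) nzx.
have tx := raises_total rx.
have Ex0 : unzip1 x0 = s by rewrite -(raises_letters rx).
have nx0 r : r \in P -> ends_nonneg A r x0.
  move=> rP w Ew; have [w' [Ew' rw]] := braid_moves_raises HA rx Ew.
  exact: raises_last rw T0 (nx r rP _ Ew').
have [|y0 [Ey0 Ly0]] := @braid_moves_letters _ _ HA p x x0 y _ py; first by rewrite Ex0 Ex.
have [|y1 [Ey1 Ly1]] := @braid_moves_letters _ _ HA q x x0 y' _ qy; first by rewrite Ex0 Ex.
have E01 : y0 = y1 by apply: IH Ey0 Ey1 _ => //; [lia | rewrite Ly0 Ly1].
have [w []] := braid_moves_raises HA rx Ey0; rewrite py => -[<-] r1.
have [w' []] := braid_moves_raises HA rx Ey1; rewrite qy -E01 => -[<-] r2.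
exact: (raises_fun HA r1 r2).
Qed.

Lemma last_nonneg_shift (N : int) x : 0 <= last 0 (unzip2 x) + N ->
  last_nonneg (shift A [ffun => N] x).
Proof.
case/lastP: x => [|x [i z]] //; rewrite -cats1 shift_cat /= !cats1 last_nonneg_rcons ffunE.
by rewrite /unzip2 map_rcons last_rcons.
Qed.

(** Translation by N rho adds N to the last coordinate along every path; one N
serves for all p in P because P is finite. *)
Lemma exists_shift_ends_nonneg x (P : seq (seq (nat * nat))) :
  exists N0, forall N, N0 <= N -> forall p, p \in P -> ends_nonneg A p (shift A [ffun => N] x).
Proof.
elim: P => [|q P [N1 H1]]; first by exists 0.
have [N2 H2] : exists N2, forall N, N2 <= N -> ends_nonneg A q (shift A [ffun => N] x).
  case Eq: (braid_moves A q x) => [y|].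
    exists (- last 0 (unzip2 y)) => N leN w; rewrite (braid_moves_shift HA _ Eq) => -[<-].
    by apply: last_nonneg_shift; rewrite -lerBlDl sub0r.
  exists 0 => N _ w Ew.
  have [|y [Ey _]] := @braid_moves_letters _ _ HA q _ x _ _ Ew; first by rewrite shift_letters.
  by rewrite Ey in Eq.
exists (max N1 N2) => N leN p; rewrite inE => /predU1P[->|pP]; first by apply: H2; lia.
by apply: H1 pP; lia.
Qed.

Theorem paths_agree s p q x y y' : longest A s -> unzip1 x = s ->
  braid_moves A p x = Some y -> braid_moves A q x = Some y' ->
  unzip1 y = unzip1 y' -> y = y'.
Proof.
move=> Ls Ex py qy Eyy; have [P HP] := coords_nonneg HA Ls.
have [N /(_ _ (lexx N)) nN] := exists_shift_ends_nonneg x P.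
apply: (@shift_inj _ A [ffun => N]) => //.
apply: (nonneg_paths_agree HP _ nN); rewrite ?shift_letters //.
- exact: braid_moves_shift py.
- exact: braid_moves_shift qy.
Qed.

Lemma braid_move_word km x y : braid_move A km x = Some y ->
  W (unzip1 y) = W (unzip1 x) /\ size y = size x.
Proof.
move=> /(braid_moveP HA)[l [u [v [r [-> -> uv _]]]]]; rewrite !size_cat (braid_rule_size uv).
split=> //; rewrite /unzip1 !map_cat !word_elt_cat; congr (_ *m (_ *m _)).
case: uv => [i k z1 z2 ik E F|i k z1 z2 z3 ik E F|i k z1 z2 z3 z4 ik E F|i k z1 z2 z3 z4 ik E F];
by have := alt_braid HA ik; rewrite /bond E F /=.
Qed.

Lemma braid_moves_word p x y : braid_moves A p x = Some y ->
  W (unzip1 y) = W (unzip1 x) /\ size y = size x.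
Proof.
elim: p x => [|km p IH] x /=; first by case=> <-.
by case E: braid_move => [w|] //= /IH[-> ->]; exact: braid_move_word E.
Qed.

Lemma exists_star_moves s i : longest A s -> exists p, star_moves A i s p.
Proof.
move=> Ls.
have R0 : reduced A [::] by [].
have Ri : reduced A [:: i].
  apply: (nonneg_reduced_rcons HA R0) => k.
  by rewrite word_elt_nil mul1mx !mxE; case: andb.
have [u [Eu Su]] := longest_extl HA Ls Ri.
have Esu : braid_eqv A s (rcons u i).
  by rewrite -cats1; apply: (matsumoto HA Ls.1) => //; rewrite size_cat.
have [p Hp] := braid_eqv_moves HA 0 Esu.
exists p, u => x /eqP Ex; have [y [Ey]] := Hp [::] x [::] erefl Ex.
rewrite /= !cats0 => My; have [b [z [Eb Lb]]] := split_rcons Ey.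
by exists b, z; rewrite My Eb /cellular Lb eqxx.
Qed.

(** The moves chosen in the definition of eps_star and the moves p may end at
words whose prefixes before i differ. Moves on the prefix, which leave the last
factor alone, bring both to the same word, where paths_agree applies. *)
Lemma eps_star_last s i x p b z : longest A s -> cellular s x ->
  braid_moves A p x = Some (rcons b (i, z)) -> eps_star A i x = - z.
Proof.
move=> Ls /eqP Ex My.
have := epsilon_spec (inhabits [::]) _ (exists_star_moves i Ls); rewrite -Ex.
rewrite /eps_star; set p0 := epsilon _ _ => -[s0] /(_ x (eqxx _))[b0 [a [/eqP Eb0 My0]]].
rewrite My0 last_rcons /=; congr (- _).
have [EW SW] := braid_moves_word My; have [EW0 SW0] := braid_moves_word My0.
move: EW EW0 SW SW0; rewrite !size_rcons /unzip1 !map_rcons -!/(unzip1 _) Ex Eb0 /=.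
move=> EW EW0 SW SW0.
have Sx : size x = size s by rewrite -Ex size_map.
have Sb : size b = size b0 by case: SW0 SW => <- [].
have Rb : reduced A (rcons (unzip1 b) i).
  by apply: (reduced_eq Ls.1) => //; rewrite size_rcons size_map SW Sx.
have Ebb : braid_eqv A (unzip1 b) s0.
  apply: (matsumoto HA).
  - by move: Rb; rewrite -cats1 => /reduced_catl.
  - by apply: (@word_elt_rcons_inj _ _ HA _ _ i); rewrite EW EW0.
  - by rewrite -Eb0 !size_map.
have [q Hq] := braid_eqv_moves HA 0 Ebb.
have [b' [Eb' My']] := Hq [::] b [:: (i, z)] erefl erefl.
rewrite /= !cats1 in My'.
have My2 : braid_moves A (p ++ q) x = Some (rcons b' (i, z)) by rewrite braid_moves_cat My.
have : rcons b0 (i, a) = rcons b' (i, z).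
  by apply: (paths_agree Ls Ex My0 My2); rewrite /unzip1 !map_rcons -!/(unzip1 _) Eb' Eb0.
by case/rcons_inj.
Qed.

(** * The characterization of the zero tensor *)

Lemma total_wt x : total x = \sum_k wt x k 0.
Proof.
transitivity (\sum_k \sum_(b <- x) (b.2 *: simple_root b.1) k 0); last first.
  by apply: eq_bigr => k _; rewrite /wt summxE.
rewrite exchange_big /total; apply: eq_bigr => -[i z] _ /=.
rewrite (bigD1 i) //= !mxE !eqxx mulr1 big1 ?addr0 // => k ki.
by rewrite !mxE (negbTE ki) mulr0.
Qed.

Lemma total_eq0 x : all_nonneg x -> total x = 0 -> zeros x.
Proof.
elim: x => [|[i z] x IH] //= /andP[/= z0 px]; have := total_ge0 px.
rewrite /total big_cons /= -/(total x) => t0 E.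
by rewrite IH //; lia.
Qed.

Lemma zeros_last (x : tensor) b0 : b0.2 = 0 -> zeros x -> (last b0 x).2 = 0.
Proof. by elim: x b0 => [|b x IH] b0 //= _ /andP[/eqP b0' /IH]; apply. Qed.

Theorem wt_eps_star_eq0P s x : longest A s -> cellular s x ->
  (wt x = 0 /\ forall i : 'I_n, eps_star A i x = 0) <-> x = cellular_zero s.
Proof.
move=> Ls sx; split=> [[wx ex]|->].
  have [P HP] := coords_nonneg HA Ls; have /eqP Ex := sx.
  have px : all_nonneg x.
    apply: HP => // p _ y; case/lastP: y => [|y [i z]] // My.
    by rewrite last_nonneg_rcons -oppr_le0 -(eps_star_last Ls sx My) ex.
  rewrite -Ex; apply/zerosP/total_eq0 => //.
  by rewrite total_wt wx big1 // => k _; rewrite mxE.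
split.
  by rewrite /wt /cellular_zero big_map big1_seq // => i _; rewrite scale0r.
move=> i; rewrite /eps_star; case E: braid_moves => [y|] //.
by rewrite zeros_last // (braid_moves_zeros HA E (zeros_cellular s)).
Qed.
End PathIndependence.

Theorem theorem7p4 (t : classical_type) (n : nat) (hn : rank_ok t n)
    (w0 : 'M[int]_n) (hw0 : longest_element (cartan t n) w0)
    (s : seq 'I_n) (hs : reduced_word (cartan t n) w0 s)
    (x : tensor n) (hx : cellular s x) :
  (wt x = 0 /\ forall i : 'I_n, eps_star (cartan t n) i x = 0)
  <-> x = cellular_zero s.
Proof.
exact: (wt_eps_star_eq0P (cartan_cartan_like t n) (reduced_word_longest hw0 hs) hx).
Qed.
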